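(* Let $H$ be a bipartite graph with no isolated vertices, and let $s:=s(H)$, $t:=t(H)$. Let $\alpha\in(0,1)$ and $\varepsilon>0$. Then there exists $n_0=n_0(s,t,\alpha,\varepsilon)$ (depending only on $s,t,\alpha,\varepsilon$) such that for every $n\ge n_0$, every graph $G$ with $n$ vertices and at least $T_{s,t}(\alpha)\binom{n}{2}$ edges contains more than $(1-\varepsilon)\frac{\alpha}{s+t}n$ vertex-disjoint copies of $H$.
   Context: Graphs are finite, simple and undirected, with at least one vertex. A copy of $H$ in $G$ is a (not necessarily induced) subgraph of $G$ isomorphic to $H$. For a bipartite graph $H$, let $b:V(H)\to\{1,2\}$ be a proper colouring of $H$ which minimizes $|b^{-1}(1)|$ among all proper colourings $V(H)\to\{1,2\}$. Set $s(H):=|b^{-1}(1)|$ and $t(H):=|b^{-1}(2)|$; thus $s(H)\le t(H)$ and $s(H)+t(H)=|V(H)|$. For positive integers $s,t$, the function $T_{s,t}:(0,1)\to(0,1)$ is defined by $$T_{s,t}(\alpha):=\max\left\{\frac{2s\alpha}{s+t}\left(1-\frac{s\alpha}{2(s+t)}\right),\ \alpha^2\right\}.$$ *)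

(* Defs.v *)
From mathcomp Require Import all_boot all_order all_algebra.
From mathcomp Require Import reals.
Set Implicit Arguments.
Unset Strict Implicit.
Unset Printing Implicit Defensive.
Import Order.TTheory GRing.Theory Num.Theory.

Record sgraph := SGraph {
  vertex :> finType;
  adj : rel vertex;
  adj_sym : symmetric adj;
  adj_irrefl : irreflexive adj;
  vertex_gt0 : 0 < #|vertex| }.

Definition edges (G : sgraph) : {set {set G}} :=
  [set [set xy.1; xy.2] | xy : G * G & adj xy.1 xy.2].

Definition no_isolated_vertex (G : sgraph) : Prop :=
  forall x : G, exists y : G, adj x y.

(* Colour 1 is [true] and colour 2 is [false]. *)
Definition proper_colouring (H : sgraph) (b : {ffun H -> bool}) : bool :=
  [forall x, forall y, adj x y ==> (b x != b y)].

Definition bipartite (H : sgraph) : Prop :=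
  exists b : {ffun H -> bool}, proper_colouring b.

Definition colour_class (H : sgraph) (b : {ffun H -> bool}) (c : bool) :
  {set H} := [set x | b x == c].

Definition minimal_colouring (H : sgraph) (b : {ffun H -> bool}) : bool :=
  proper_colouring b &&
  [forall b' : {ffun H -> bool}, proper_colouring b' ==>
    (#|colour_class b true| <= #|colour_class b' true|)].

(* The default colouring is a dummy value, reached only when [H] is not
   bipartite: see [min_colouringP]. *)
Definition min_colouring (H : sgraph) : {ffun H -> bool} :=
  odflt [ffun=> true] [pick b : {ffun H -> bool} | minimal_colouring b].

Definition s_of (H : sgraph) : nat := #|colour_class (min_colouring H) true|.
Definition t_of (H : sgraph) : nat := #|colour_class (min_colouring H) false|.

Lemma min_colouringP (H : sgraph) :
  bipartite H -> minimal_colouring (min_colouring H).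
Proof.
case=> b0 b0P; rewrite /min_colouring; case: pickP => [b //|noP].
case: (arg_minnP (fun b : {ffun H -> bool} => #|colour_class b true|) b0P).
move=> b bP bmin; have := noP b; rewrite /minimal_colouring bP /=.
by move/negP; case; apply/forallP => b'; apply/implyP; apply: bmin.
Qed.

Lemma s_of_add_t_of (H : sgraph) : s_of H + t_of H = #|H|.
Proof.
rewrite /s_of /t_of -(cardsC (colour_class (min_colouring H) true)).
by congr (_ + #|pred_of_set _|); apply/setP => x; rewrite !inE; case: (_ x).
Qed.

Lemma s_of_le_t_of (H : sgraph) : bipartite H -> s_of H <= t_of H.
Proof.
move=> /min_colouringP /andP[/forallP bP /forallP bmin].
pose b' : {ffun H -> bool} := [ffun x => ~~ min_colouring H x].
have b'P : proper_colouring b'.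
  apply/forallP => x; apply/forallP => y; apply/implyP => xy; rewrite !ffunE.
  by have := bP x => /forallP/(_ y); rewrite xy /=; do 2!case: (min_colouring H _).
apply: leq_trans (implyP (bmin b') b'P) _.
by apply: subset_leq_card; apply/subsetP => x; rewrite !inE ffunE; case: (_ x).
Qed.

(* A not necessarily induced, possibly empty, subgraph of [G]. *)
Record subgraph (G : sgraph) := Subgraph {
  sub_vertices : {set G};
  sub_adj : rel G;
  sub_adj_sym : symmetric sub_adj;
  sub_adj_vertices : forall x y, sub_adj x y -> x \in sub_vertices;
  sub_adj_adj : forall x y, sub_adj x y -> adj x y }.

Definition is_copy (H G : sgraph) (S : subgraph G) : Prop :=
  exists f : H -> G,
    [/\ injective f, f @: [set: H] = sub_vertices S
      & forall x y : H, sub_adj S (f x) (f y) = adj x y].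

Definition vertex_disjoint_copies (H G : sgraph) (k : nat)
    (C : 'I_k -> subgraph G) : Prop :=
  (forall i, is_copy H (C i)) /\
  (forall i j, i != j -> [disjoint sub_vertices (C i) & sub_vertices (C j)]).

Local Open Scope ring_scope.

Definition T_fun (R : realType) (s t : nat) (alpha : R) : R :=
  Num.max
    (2 * s%:R * alpha / (s%:R + t%:R)
       * (1 - s%:R * alpha / (2 * (s%:R + t%:R))))
    (alpha ^+ 2).

(* Main.v *)
(**
H is contained in K_{s,t}, so it is enough to tile G with copies of K_{s,t}.

Partition V(G) into boundedly many cells so that almost all edges lie in pairs of
cells (X, Y) that are lower-dense: all large X' in X and Y' in Y span at least
d |X'| |Y'| edges. Only this one-sided regularity is needed, and an easy potential
replaces the energy of Szemerédi's lemma: a pair that is not lower-dense contains a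
sparse rectangle X' x Y', which is discarded for good while the partition is refined
so as to see X' and Y'. The discarded area grows by a constant proportion of n^2 in
each round, and it contains few edges.

A fractional tiling of the reduced graph by copies of K_{s,t} is realised greedily in
G, since lower-dense pairs keep containing K_{s,t} until they are nearly used up. An
optimal fractional tiling with as much slack as possible is read off as follows: let
C be the cells with slack, A the neighbours of C, and B the other cells. Exchanging
tiles shows that C sees only A, and that every tile at a cell of A has its other end
in C; hence the tiling has weight at least |A| / s + |B| / (s + t). So if the tiling
is too small, then G is essentially contained in the graph with A joined to everything,
B complete and C independent, with |A| / s + |B| / (s + t) <= beta n / (s + t) for some
beta < alpha. Its number of edges is a convex function of |A|, and the two extreme cases
B = 0 and A = 0 are the two terms of the maximum defining T_{s,t}. *)
Require Import Defs.
From mathcomp Require Import all_boot all_order all_algebra.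
From mathcomp Require Import reals boolp.
From mathcomp Require classical_sets topology normedtype derive.
From mathcomp Require Import ring lra.
Set Implicit Arguments.
Unset Strict Implicit.
Unset Printing Implicit Defensive.
Import Order.TTheory GRing.Theory Num.Theory.
Local Open Scope ring_scope.

(** * Optimal fractional tilings *)

Section LinearProgram.
Import classical_sets topology normedtype derive numFieldNormedType.Exports.

(** The bounds [M] make the feasible set a closed subset of a compact box of row vectors, so the
    continuous objective attains its maximum there. *)
Lemma linear_program_max (R : realType) (K J : finType) (a : J -> K -> R)
    (b : J -> R) (M : K -> R)
    (feasible := fun w : K -> R => (forall k, 0 <= w k <= M k) /\
       forall j, \sum_k a j k * w k <= b j) :
  (exists w, feasible w) ->
  exists2 w, feasible w & forall w', feasible w' -> \sum_k w' k <= \sum_k w k.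
Proof.
move=> [w0 w0F].
pose coord (k : K) (x : 'rV[R]_#|K|) : R := x ord0 (enum_rank k).
have coord_row (w : K -> R) : coord ^~ (\row_i w (enum_val i)) = w.
  by apply/funext => k; rewrite /coord mxE enum_rankK.
have coord_cts k : continuous (coord k) by move=> x; exact: coord_continuous.
have sum_cts c : continuous (fun x => \sum_k c k * coord k x).
  apply: continuous_big => [|k _ x]; first exact: add_continuous.
  by apply: continuousM; [exact: cst_continuous | exact: coord_cts].
pose A := [set x | feasible (coord ^~ x)]%classic.
have A0 : (A !=set0)%classic.
  by exists (\row_i w0 (enum_val i)); rewrite /A /= coord_row.
have cA : compact A.
  pose box := [set x : 'rV[R]_#|K| | forall i,
    `[0, M (enum_val i)]%classic (x ord0 i)]%classic.
  apply: (@subclosed_compact _ _ box).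
  - have -> : A = (\bigcap_(k in [set: K]) (coord k @^-1` [set y | (0 <= y)%R] `&`
        coord k @^-1` [set y | (y <= M k)%R]) `&` \bigcap_(j in [set: J])
        ((fun x => (\sum_k a j k * coord k x)%R) @^-1` [set y | (y <= b j)%R]))%classic.
      apply/seteqP; split=> x /=.
        move=> [h1 h2]; split=> [i _|j _] /=; last exact: h2.
        by apply/andP; apply: h1.
      move=> [h1 h2]; split=> [k|j]; last exact: h2.
      by apply/andP; apply: h1.
    apply: closedI; apply: closed_bigI => k _; last first.
      by apply: preimage_closed => [x _|]; [exact: sum_cts | exact: closed_le].
    apply: closedI; apply: preimage_closed => [x _|]; try exact: coord_cts.
      exact: closed_ge.
    exact: closed_le.
  - apply: (@rV_compact R _ (fun i => `[0, M (enum_val i)]%classic)) => i.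
    exact: segment_compact.
  - move=> x [h1 _] i /=.
    by have := h1 (enum_val i); rewrite /coord enum_valK in_itv.
have [|x xA xmax] := @EVT_max_rV R _ (fun x => \sum_k 1 * coord k x) A A0 cA.
  by apply: continuous_subspaceT; apply: sum_cts.
exists (coord ^~ x); first exact: (set_mem xA).
move=> w' w'F; have := xmax (\row_i w' (enum_val i)).
have rowA : A (\row_i w' (enum_val i)) by rewrite /A /= coord_row.
move=> /(_ (mem_set rowA)).
under eq_bigr do rewrite mul1r; under [X in _ <= X -> _]eq_bigr do rewrite mul1r.
by congr (_ <= _); apply: eq_bigr => k _; rewrite -[in RHS](coord_row w').
Qed.

End LinearProgram.

(** Elements of [T] stand for cells, and [w i j] is the amount of tiles $K_{s,t}$ with their
    [s]-side in [i] and their [t]-side in [j]. The order matters, and [i = j] is allowed. *)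
Definition tile_load (R : realType) (T : finType) (s t : R) (w : T -> T -> R)
    (i : T) : R :=
  \sum_j (s * w i j + t * w j i).

Definition fractional_tiling (R : realType) (T : finType) (al : rel T)
    (v : T -> R) (s t : R) (w : T -> T -> R) : Prop :=
  [/\ forall i j, 0 <= w i j, forall i j, ~~ al i j -> w i j = 0
    & forall i, tile_load s t w i <= v i].

Definition tiling_weight (R : realType) (T : finType) (w : T -> T -> R) : R :=
  \sum_i \sum_j w i j.

Definition add_tile (R : realType) (T : finType) (w : T -> T -> R) (i j : T)
    (x : R) (k l : T) : R :=
  w k l + x * ((k == i) && (l == j))%:R.

Lemma sum_delta (R : pzRingType) (T : finType) (F : T -> R) (i : T) :
  \sum_k F k * (k == i)%:R = F i.
Proof.
rewrite (bigD1 i) //= eqxx mulr1 big1 ?addr0 // => k /negbTE ->.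
by rewrite mulr0.
Qed.

Lemma weight_pairs (R : realType) (T : finType) (w : T -> T -> R) :
  tiling_weight w = \sum_p w p.1 p.2.
Proof. exact: pair_bigA. Qed.

Lemma load_pairs (R : realType) (T : finType) (s t : R) (w : T -> T -> R) i :
  tile_load s t w i = \sum_p (s * (p.1 == i)%:R + t * (p.2 == i)%:R) * w p.1 p.2.
Proof.
rewrite -(pair_bigA _ (fun k l => (s * (k == i)%:R + t * (l == i)%:R) * w k l)) /=.
transitivity (\sum_k ((\sum_l s * w k l) * (k == i)%:R + t * w k i)).
  by rewrite big_split /= sum_delta -big_split.
apply: eq_bigr => k _; rewrite mulr_suml -(sum_delta (fun l => t * w k l) i).
by rewrite -big_split; apply: eq_bigr => l _ /=; ring.
Qed.

Lemma weight_add_tile (R : realType) (T : finType) (w : T -> T -> R) i j x :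
  tiling_weight (add_tile w i j x) = tiling_weight w + x.
Proof.
rewrite /tiling_weight (eq_bigr (fun k => \sum_l w k l + x * (k == i)%:R)) => [|k _].
  by rewrite big_split /= sum_delta.
rewrite big_split /= -(sum_delta (fun=> x * (k == i)%:R) j); congr (_ + _).
by apply: eq_bigr => l _; rewrite -mulnb natrM mulrA.
Qed.

Lemma load_add_tile (R : realType) (T : finType) (s t : R) (w : T -> T -> R) i j x k :
  tile_load s t (add_tile w i j x) k =
    tile_load s t w k + s * x * (k == i)%:R + t * x * (k == j)%:R.
Proof.
rewrite /tile_load -addrA.
rewrite -(sum_delta (fun=> s * x * (k == i)%:R) j).
rewrite -(sum_delta (fun=> t * x * (k == j)%:R) i) -!big_split /=.
by apply: eq_bigr => l _; rewrite /add_tile -!mulnb !natrM; ring.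
Qed.

Lemma load_half (R : realType) (T : finType) (s t : R) (w w' : T -> T -> R) i :
  tile_load s t (fun k l => (w k l + w' k l) / 2) i =
    (tile_load s t w i + tile_load s t w' i) / 2.
Proof.
by rewrite /tile_load -big_split mulr_suml; apply: eq_bigr => k _ /=; field.
Qed.

Lemma weight_half (R : realType) (T : finType) (w w' : T -> T -> R) :
  tiling_weight (fun k l => (w k l + w' k l) / 2) =
    (tiling_weight w + tiling_weight w') / 2.
Proof.
rewrite /tiling_weight -big_split mulr_suml; apply: eq_bigr => k _ /=.
by rewrite -mulr_suml big_split.
Qed.

Lemma optimal_tiling (R : realType) (T : finType) (al : rel T)
    (v : T -> R) (s t : R) : 0 < s -> 0 < t -> (forall i, 0 <= v i) ->
  exists2 w, fractional_tiling al v s t w &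
    forall w', fractional_tiling al v s t w' -> tiling_weight w' <= tiling_weight w.
Proof.
move=> s0 t0 v0.
pose a (i : T) (p : T * T) : R := s * (p.1 == i)%:R + t * (p.2 == i)%:R.
(* On allowed pairs this bound already follows from the load at the first cell; on the others it
   encodes the support condition. *)
pose M (p : T * T) : R := if al p.1 p.2 then v p.1 / s else 0.
have loadE (w : T * T -> R) i :
    \sum_p a i p * w p = tile_load s t (fun k l => w (k, l)) i.
  by rewrite load_pairs; apply: eq_bigr => -[].
have tilingP (w : T * T -> R) : fractional_tiling al v s t (fun k l => w (k, l)) <->
    (forall p, 0 <= w p <= M p) /\ forall i, \sum_p a i p * w p <= v i.
  split=> [[w0 wal wv]|[wM wv]].
    split=> [[k l]|i]; last by rewrite loadE.
    rewrite w0 /M /=; case: ifPn => [_|/wal ->] //.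
    rewrite ler_pdivlMr //; apply: le_trans (wv k).
    rewrite /tile_load (bigD1 l) //= mulrC -addrA lerDl addr_ge0 //.
      by rewrite mulr_ge0 // ltW.
    by rewrite sumr_ge0 // => j _; rewrite addr_ge0 // mulr_ge0 // ltW.
  split=> [i j|i j /negbTE nal|i]; last by rewrite -loadE.
    by have /andP[] := wM (i, j).
  by apply: le_anti; rewrite andbC; have := wM (i, j); rewrite /M /= nal.
have weightE (w : T * T -> R) : \sum_p w p = tiling_weight (fun k l => w (k, l)).
  by rewrite weight_pairs; apply: eq_bigr => -[].
have [|w /tilingP wF wmax] := @linear_program_max R _ _ a v M.
  exists (fun=> 0); apply/tilingP; split=> // i.
  by rewrite /tile_load big1 // => j _; rewrite !mulr0 addr0.
exists (fun k l => w (k, l)) => // w' w'F.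
have := wmax (fun p => w' p.1 p.2); rewrite !weightE; apply.
exact/tilingP.
Qed.

Definition slack_set (R : realType) (T : finType) (v : T -> R) (s t : R)
    (w : T -> T -> R) : {set T} := [set i | tile_load s t w i < v i].

(** The average of two optimal tilings is optimal and has slack wherever either of them has. Hence
    an optimal tiling with the largest number of slack cells has slack wherever any optimal tiling
    has. *)
Lemma optimal_tiling_max_slack (R : realType) (T : finType) (al : rel T)
    (v : T -> R) (s t : R) : 0 < s -> 0 < t -> (forall i, 0 <= v i) ->
  exists w, [/\ fractional_tiling al v s t w,
    forall w', fractional_tiling al v s t w' -> tiling_weight w' <= tiling_weight w
    & forall w', fractional_tiling al v s t w' -> tiling_weight w' = tiling_weight w ->
        slack_set v s t w' \subset slack_set v s t w].
Proof.
move=> s0 t0 v0; have [w0 w0F w0max] := optimal_tiling al s0 t0 v0.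
pose P n := `[< exists w, [/\ fractional_tiling al v s t w,
  tiling_weight w = tiling_weight w0 & #|slack_set v s t w| = n] >].
have exP : exists n, P n by exists #|slack_set v s t w0|; apply/asboolP; exists w0.
have leP n : P n -> (n <= #|T|)%N.
  by move=> /asboolP[w [_ _ <-]]; apply: max_card.
case: (ex_maxnP exP leP) => _ /asboolP[w [wF ww0 <-]] wmax.
exists w; split=> //; first by rewrite ww0.
move=> w' w'F; rewrite ww0 => w'w0.
pose h k l := (w k l + w' k l) / 2.
have [[w_ge0 w_al w_v] [w'_ge0 w'_al w'_v]] := (wF, w'F).
have hF : fractional_tiling al v s t h.
  split=> [i j|i j nal|i].
  - by rewrite divr_ge0 // addr_ge0.
  - by rewrite /h w_al // w'_al // addr0 mul0r.
  - by rewrite load_half; have := w_v i; have := w'_v i; lra.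
have hw : tiling_weight h = tiling_weight w0 by rewrite weight_half w'w0 ww0; field.
have sub : slack_set v s t w :|: slack_set v s t w' \subset slack_set v s t h.
  apply/subsetP => i; rewrite !inE load_half.
  by have := w_v i; have := w'_v i => ? ? /orP[] ?; lra.
have /wmax le_h : P #|slack_set v s t h| by apply/asboolP; exists h.
have/eqP <- : slack_set v s t w :|: slack_set v s t w' == slack_set v s t w.
  rewrite eq_sym eqEcard subsetUl /=.
  by apply: leq_trans le_h; apply: subset_leq_card.
exact: subsetUr.
Qed.

(** The factors of [v i] are prices of capacity. Cells with slack are free and all others are full,
    so the total price is a sum over tiles, and it suffices that each tile in use costs at most
    1. *)
Lemma tiling_duality (R : realType) (T : finType) (al : rel T) (v : T -> R)
    (s t : R) : 0 < s -> s <= t -> (forall i, 0 <= v i) ->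
  exists (w : T -> T -> R) (A C : {set T}),
  [/\ fractional_tiling al v s t w, [disjoint A & C],
      forall i j, i \in C -> al j i -> j \in A
    & \sum_i v i * (if i \in A then s^-1 else if i \in C then 0 else (s + t)^-1)
        <= tiling_weight w].
Proof.
move=> s0 st v0; have t0 : 0 < t by apply: lt_le_trans st.
have [w [wF wmax wslack]] := optimal_tiling_max_slack al s0 t0 v0.
have [w_ge0 w_al w_v] := wF.
pose C := slack_set v s t w.
pose A := [set j | [exists i in C, al j i]].
have CC i j : i \in C -> j \in C -> al j i -> False.
  rewrite !inE => iC jC alji.
  (* An allowed pair with slack at both ends has room for one more tile. Dividing by [s + t] covers
     [i = j], where one cell carries both sides. *)
  pose x := Num.min (v i - tile_load s t w i) (v j - tile_load s t w j) / (s + t).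
  have st0 : 0 < s + t by rewrite addr_gt0.
  have x0 : 0 < x by rewrite divr_gt0 // lt_min !subr_gt0 iC.
  have xi : (s + t) * x <= v i - tile_load s t w i.
    by rewrite mulrC divfK ?gt_eqF // ge_min lexx.
  have xj : (s + t) * x <= v j - tile_load s t w j.
    by rewrite mulrC divfK ?gt_eqF // ge_min lexx orbT.
  have sx : 0 < s * x by rewrite mulr_gt0.
  have tx : 0 < t * x by rewrite mulr_gt0.
  have : tiling_weight (add_tile w j i x) <= tiling_weight w.
    apply: wmax; split=> [k l|k l nal|k].
    - by rewrite addr_ge0 // mulr_ge0 // ltW.
    - rewrite /add_tile w_al //; case: eqP => [ek|_]; last by rewrite mulr0 addr0.
      by case: eqP => [el|_]; [rewrite ek el alji in nal | rewrite mulr0 addr0].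
    - rewrite load_add_tile; have := w_v k.
      by case: eqVneq => [->|_]; case: eqVneq => [->|_];
        rewrite ?mulr1 ?mulr0 ?addr0 => ?; lra.
  by rewrite weight_add_tile; lra.
have dAC : [disjoint A & C].
  rewrite disjoint_subset; apply/subsetP => j; rewrite inE => /exists_inP[i iC alji].
  by apply/negP => jC; apply: (CC i j).
(* Trading a little of a tile at a vertex [j] of [A] for a tile reaching into the
   slack of [C] keeps the tiling_weight, so the capacity that it frees lies in [C]. *)
have exchange i j p q k : i \in C -> al j i -> w p q != 0 ->
    (j == p) || (j == q) ->
    s * (k == j)%:R < s * (k == p)%:R + t * (k == q)%:R -> k \in C.
  move=> iC alji wpq jpq kpq; have [->//|ki] := eqVneq k i.
  have wpq0 : 0 < w p q by rewrite lt_neqAle eq_sym wpq w_ge0.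
  have alpq : al p q by apply/negP => /negP/w_al/eqP; rewrite (negbTE wpq).
  have slack0 : 0 < v i - tile_load s t w i by move: iC; rewrite inE subr_gt0.
  pose x := Num.min (w p q) ((v i - tile_load s t w i) / t).
  have x0 : 0 < x by rewrite lt_min wpq0 divr_gt0.
  have xw : x <= w p q by rewrite ge_min lexx.
  have xi : t * x <= v i - tile_load s t w i.
    by rewrite mulrC -ler_pdivlMr // ge_min lexx orbT.
  have sx : 0 < s * x by rewrite mulr_gt0.
  have stx : s * x <= t * x by rewrite ler_pM2r.
  pose w' := add_tile (add_tile w j i x) p q (- x).
  have w'F : fractional_tiling al v s t w'.
    split=> [a b|a b nal|a].
    - rewrite /w' /add_tile; have := w_ge0 a b; have : 0 <= x * ((a == j) && (b == i))%:R.
        by rewrite mulr_ge0 // ltW.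
      case: (a =P p) => [->|_]; case: (b =P q) => [->|_];
        rewrite ?mulr1 ?mulr0 ?addr0; lra.
    - rewrite /w' /add_tile w_al //.
      have -> : (a == j) && (b == i) = false.
        by apply: contraNF nal => /andP[/eqP -> /eqP ->].
      have -> : (a == p) && (b == q) = false.
        by apply: contraNF nal => /andP[/eqP -> /eqP ->].
      by rewrite !mulr0 !addr0.
    - rewrite !load_add_tile !mulrN !mulNr.
      have le_i : t * x * (a == i)%:R <= v a - tile_load s t w a.
        have [->|_] := eqVneq a i; first by rewrite mulr1.
        by rewrite mulr0 subr_ge0.
      (* The new tile has its [s]-side at [j]; since [s <= t], the removed one frees at least as
         much there, whichever of its sides [j] carried. *)
      have : s * x * (a == j)%:R <= s * x * (a == p)%:R + t * x * (a == q)%:R.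
        have [sx_ge0 tx_ge0] : 0 <= s * x /\ 0 <= t * x by lra.
        case/orP: jpq => /eqP <-; first by rewrite lerDl mulr_ge0.
        by apply: ler_wpDl; [rewrite mulr_ge0 | apply: ler_wpM2r].
      lra.
  have : k \in slack_set v s t w'.
    rewrite inE !load_add_tile (negbTE ki) mulr0 addr0; have := w_v k.
    move: kpq; rewrite -(ltr_pM2r x0); lra.
  by apply/subsetP/wslack; rewrite // !weight_add_tile; ring.
exists w, A, C; split=> //.
  by move=> i j iC alji; rewrite inE; apply/exists_inP; exists i.
pose c i := if i \in A then s^-1 else if i \in C then 0 else (s + t)^-1.
have -> : \sum_i v i * c i = \sum_i \sum_j w i j * (s * c i + t * c j).
  transitivity (\sum_i \sum_j (s * w i j * c i + t * w j i * c i)).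
    apply: eq_bigr => i _; under [RHS]eq_bigr do rewrite -mulrDl.
    rewrite -mulr_suml -/(tile_load s t w i).
    have [iC|] := boolP (i \in C); last first.
      by rewrite inE -leNgt => ?; congr (_ * _); apply: le_anti; rewrite w_v andbT.
    by rewrite /c (disjointFl dAC iC) iC !mulr0.
  under eq_bigr do rewrite big_split.
  rewrite big_split /= [X in _ + X]exchange_big -big_split /=.
  by apply: eq_bigr => i _; rewrite -big_split; apply: eq_bigr => j _ /=; ring.
apply: ler_sum => i _; apply: ler_sum => j _.
have [->|wij] := eqVneq (w i j) 0; first by rewrite mul0r.
suff : s * c i + t * c j <= 1.
  by rewrite -[X in _ -> _ <= X]mulr1; apply: ler_wpM2l.
have notC k : k \in A -> k \in C -> False by move=> kA; rewrite (disjointFr dAC kA).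
have [iA|iA] := boolP (i \in A).
  have := iA; rewrite inE => /exists_inP[k kC alik].
  have ex := exchange k i i j _ kC alik wij _.
  have ij : j != i.
    apply/eqP => ji; apply: (notC i iA); apply: ex; first by rewrite eqxx.
    by rewrite ji eqxx !mulr1; lra.
  have jC : j \in C.
    apply: ex; first by rewrite eqxx.
    by rewrite (negbTE ij) eqxx !mulr1 !mulr0 ?add0r ?addr0; lra.
  by rewrite /c iA (disjointFl dAC jC) jC mulr0 addr0 divff // gt_eqF.
have [jA|jA] := boolP (j \in A).
  have := jA; rewrite inE => /exists_inP[k kC aljk].
  have ex := exchange k j i j _ kC aljk wij _.
  have ij : i != j by apply: contraNneq iA => ->.
  have iC : i \in C.
    apply: ex; first by rewrite eqxx orbT.
    by rewrite (negbTE ij) eqxx !mulr1 !mulr0 ?add0r ?addr0; lra.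
  rewrite /c (negbTE iA) iC jA mulr0 add0r ler_pdivrMr // mul1r leNgt.
  (* If [s < t], exchanging a tile with its [t]-side at [j] would leave slack at [j] itself. So such
     a tile forces [s = t], and then its price is 1. *)
  apply/negP => lt_st; apply: (notC j jA); apply: ex; first by rewrite eqxx orbT.
  by rewrite eq_sym (negbTE ij) eqxx !mulr1 !mulr0 ?add0r ?addr0; lra.
have c_le k : k \notin A -> c k <= (s + t)^-1.
  move=> /negbTE; rewrite /c => ->; case: ifP => // _.
  by rewrite invr_ge0 addr_ge0 // ltW.
have st0 : 0 < s + t by rewrite addr_gt0.
apply: (@le_trans _ _ (s * (s + t)^-1 + t * (s + t)^-1)).
  by apply: lerD; rewrite ler_pM2l // c_le.
by rewrite -mulrDl divff // gt_eqF.
Qed.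

(** * One-sided regularity *)

Definition arcs (V : finType) (e : rel V) : {set V * V} :=
  [set z | e z.1 z.2].

Definition lower_dense (R : realType) (V : finType) (e : rel V) (d delta : R)
    (X Y : {set V}) : bool :=
  [forall X' : {set V}, forall Y' : {set V},
    [&& X' \subset X, Y' \subset Y, delta * #|X|%:R <= #|X'|%:R
      & delta * #|Y|%:R <= #|Y'|%:R] ==>
    (d * #|setX X' Y'|%:R <= #|setX X' Y' :&: arcs e|%:R)].

Definition cell (V T : finType) (p : V -> T) (i : T) : {set V} := p @^-1: [set i].

(** In what follows [D] marks the pairs of cells discarded so far, and the size of the region is the
    potential that grows. *)
Definition region (V T : finType) (p : V -> T) (D : rel T) : {set V * V} :=
  [set z | D (p z.1) (p z.2)].

Definition not_lower_dense (R : realType) (V T : finType) (e : rel V) (d delta : R)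
    (p : V -> T) (D : rel T) : rel T :=
  fun i j => ~~ D i j && ~~ lower_dense e d delta (cell p i) (cell p j).

Lemma card_fibers (U T : finType) (f : U -> T) (A : {set U}) :
  #|A| = (\sum_k #|[set z in A | f z == k]|)%N.
Proof.
rewrite -sum1_card (partition_big f xpredT) //=.
by apply: eq_bigr => k _; rewrite -sum1_card; apply: eq_bigl => z; rewrite !inE.
Qed.

(** Each bad pair of cells contains a sparse rectangle filling at least a fraction [delta ^+ 2] of
    it. These rectangles are disjoint from each other and from the old region, so areas and arc
    counts add up when they are discarded. *)
Lemma refine_partition (R : realType) (V T : finType) (e : rel V) (d delta : R)
    (p : V -> T) (D : rel T) : 0 <= delta ->
  exists (p' : V -> T * {set T} * {set T}) (D' : rel (T * {set T} * {set T})),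
    (#|region p D :&: arcs e|%:R <= d * #|region p D|%:R ->
     #|region p' D' :&: arcs e|%:R <= d * #|region p' D'|%:R) /\
    #|region p D|%:R + delta ^+ 2 * #|region p (not_lower_dense e d delta p D)|%:R
      <= #|region p' D'|%:R.
Proof.
move=> delta0; pose bad := not_lower_dense e d delta p D.
pose wit i j (XY : {set V} * {set V}) := [&& XY.1 \subset cell p i,
  XY.2 \subset cell p j, delta * #|cell p i|%:R <= #|XY.1|%:R,
  delta * #|cell p j|%:R <= #|XY.2|%:R
  & #|setX XY.1 XY.2 :&: arcs e|%:R < d * #|setX XY.1 XY.2|%:R].
(* The default never occurs at a bad pair, and [D'] consults the rectangles of bad pairs only. *)
pose XY i j := odflt (set0, set0) [pick XY | wit i j XY].
have witP i j : bad i j -> wit i j (XY i j).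
  move=> /andP[_ /forallPn[X /forallPn[Y]]]; rewrite negb_imply -ltNge => XYP.
  rewrite /XY; case: pickP => [//|/(_ (X, Y))]; rewrite /wit /=.
  by case/andP: XYP => /and4P[-> -> -> ->] ->.
(* The new cell of [x] records, besides its old cell [i], the cells [j] such that
   [x] lies in the first set of the sparse rectangle in [(i, j)], and those such
   that it lies in the second set of the one in [(j, i)]. *)
pose p' x := (p x, [set j | x \in (XY (p x) j).1], [set j | x \in (XY j (p x)).2]).
pose D' (a b : T * {set T} * {set T}) := D a.1.1 b.1.1 ||
  [&& bad a.1.1 b.1.1, b.1.1 \in a.1.2 & a.1.1 \in b.2].
pose N := [set z | [&& bad (p z.1) (p z.2), z.1 \in (XY (p z.1) (p z.2)).1
  & z.2 \in (XY (p z.1) (p z.2)).2]].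
have regE : region p' D' = region p D :|: N by apply/setP => z; rewrite !inE /D' /= !inE.
have disj : [disjoint region p D & N].
  rewrite disjoint_subset; apply/subsetP => z.
  by rewrite !inE /bad /not_lower_dense => ->.
have fiber ij : [set z in N | (p z.1, p z.2) == ij] =
    if bad ij.1 ij.2 then setX (XY ij.1 ij.2).1 (XY ij.1 ij.2).2 else set0.
  case: ij => i j /=; apply/setP => z; rewrite inE; case: ifPn => bij; last first.
    rewrite !inE xpair_eqE; apply/negP => /andP[/and3P[b _ _] /andP[/eqP pi /eqP pj]].
    by rewrite -pi -pj b in bij.
  rewrite !inE; apply/andP/andP => [[/and3P[_ zX zY] /eqP[<- <-]] //|[zX zY]].
  have /and5P[/subsetP /(_ _ zX) + /subsetP /(_ _ zY) + _ _ _] := witP _ _ bij.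
  by rewrite !inE => /eqP -> /eqP ->; rewrite bij zX zY eqxx.
have bad_fiber ij : [set z in region p bad | (p z.1, p z.2) == ij] =
    if bad ij.1 ij.2 then setX (cell p ij.1) (cell p ij.2) else set0.
  case: ij => i j /=; apply/setP => z; rewrite !inE xpair_eqE.
  case: ifP => bij; rewrite !inE.
    by rewrite andbC; case: eqP => // ->; case: eqP => // ->; rewrite bij.
  by rewrite andbC; case: eqP => // ->; case: eqP => // ->; rewrite bij.
exists p', D'; rewrite regE setIUl !cardsU (disjoint_setI0 disj) cards0 subn0.
split=> [inv|].
  have -> : region p D :&: arcs e :&: (N :&: arcs e) = set0.
    by rewrite setIACA (disjoint_setI0 disj) set0I.
  rewrite cards0 subn0 !natrD mulrDr; apply: lerD => //.
  rewrite (card_fibers (fun z => (p z.1, p z.2)) (N :&: arcs e)).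
  rewrite (card_fibers (fun z => (p z.1, p z.2)) N) !natr_sum mulr_sumr.
  apply: ler_sum => ij _; rewrite fiber.
  have -> : [set z in N :&: arcs e | (p z.1, p z.2) == ij] =
      [set z in N | (p z.1, p z.2) == ij] :&: arcs e.
    by apply/setP => z; rewrite !inE -!andbA; do !bool_congr.
  rewrite fiber; case: ifP => [/witP /and5P[_ _ _ _ /ltW] //|_].
  by rewrite set0I cards0 mulr0.
rewrite natrD lerD2l.
rewrite (card_fibers (fun z => (p z.1, p z.2)) (region _ _)).
rewrite (card_fibers (fun z => (p z.1, p z.2)) N) !natr_sum mulr_sumr.
apply: ler_sum => ij _; rewrite bad_fiber fiber.
case: ifP => [/witP /and5P[_ _ le1 le2 _]|_]; last by rewrite cards0 mulr0.
rewrite !cardsX !natrM expr2 mulrACA.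
by apply: ler_pM => //; rewrite mulr_ge0.
Qed.

(** The index type after [r] refinements does not depend on the graph, which makes the bound on the
    number of cells uniform. *)
Fixpoint cell_type (r : nat) : finType :=
  if r is r'.+1 then (cell_type r' * {set cell_type r'} * {set cell_type r'})%type
  else unit.

(** A round that starts with too large a bad area discards a further [delta ^+ 2 * gamma] proportion
    of all pairs. *)
Lemma partition_rounds (R : realType) (V : finType) (e : rel V)
    (d delta gamma : R) (r : nat) : 0 <= d -> 0 <= delta ->
  (exists r' (p : V -> cell_type r') (D : rel (cell_type r')),
    [/\ (r' <= r)%N, #|region p D :&: arcs e|%:R <= d * #|region p D|%:R
      & #|region p (not_lower_dense e d delta p D)|%:R <= gamma * #|V|%:R ^+ 2]) \/
  (exists (p : V -> cell_type r) (D : rel (cell_type r)),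
    #|region p D :&: arcs e|%:R <= d * #|region p D|%:R /\
    r%:R * (delta ^+ 2 * (gamma * #|V|%:R ^+ 2)) <= #|region p D|%:R).
Proof.
move=> d0 delta0; elim: r => [|r [[r' [p [D [r'r]]]]|[p [D [inv area]]]]].
- right; exists (fun=> tt), (fun _ _ => false).
  have -> : region (fun _ : V => tt) (fun _ _ => false) = set0.
    by apply/setP => z; rewrite !inE.
  by rewrite set0I cards0 mul0r mulr0.
- by left; exists r', p, D; split=> //; apply: leqW.
have [small|large] := lerP #|region p (not_lower_dense e d delta p D)|%:R
  (gamma * #|V|%:R ^+ 2).
  by left; exists r, p, D; split.
right; have [p' [D' [inv' area']]] := refine_partition e d p D delta0.
exists p', D'; split; first exact: inv'.
apply: le_trans area'; rewrite -natr1 mulrDl mul1r lerD //.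
by rewrite ler_wpM2l ?exprn_ge0 // ltW.
Qed.

Lemma dense_partition (R : realType) (d delta gamma : R) :
  0 <= d -> 0 < delta -> 0 < gamma ->
  exists K : nat, forall (V : finType) (e : rel V),
  exists (T : finType) (p : V -> T) (D : rel T),
    [/\ (#|T| <= K)%N, #|region p D :&: arcs e|%:R <= d * #|V|%:R ^+ 2
      & #|region p (not_lower_dense e d delta p D)|%:R <= gamma * #|V|%:R ^+ 2].
Proof.
move=> d0 delta0 gamma0.
pose x := (delta ^+ 2 * gamma)^-1.
(* After this many unsuccessful rounds the discarded area would exceed the number of all pairs. *)
pose r := (Num.bound x).
exists (\max_(r' < r.+1) #|cell_type r'|)%N => V e.
have V2 (A : {set V * V}) : #|A|%:R <= #|V|%:R ^+ 2 :> R.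
  by rewrite -natrX ler_nat expnS expn1 -card_prod max_card.
have [[r' [p [D [r'r inv bad]]]]|[p [D [_ area]]]] :=
  partition_rounds e gamma r d0 (ltW delta0).
  exists (cell_type r'), p, D; split=> //.
    by apply: (leq_bigmax (Ordinal (r'r : (r' < r.+1)%N))).
  by apply: le_trans inv _; rewrite ler_wpM2l.
(* The area argument needs a strict inequality, so the empty vertex set is treated apart. *)
have [V0|V0] := posnP #|V|.
  exists unit, (fun=> tt), (fun _ _ => false); rewrite V0 expr0n /= !mulr0.
  have A0 (A : {set V * V}) : #|A|%:R = 0 :> R.
    by apply: le_anti; rewrite ler0n andbT; have := V2 A; rewrite V0 expr0n.
  split; rewrite ?A0 //.
  by rewrite card_unit; apply: leq_trans (leq_bigmax (ord0 : 'I_r.+1)); rewrite card_unit.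
have V20 : 0 < #|V|%:R ^+ 2 :> R by rewrite exprn_gt0 // ltr0n.
have dg : 0 < delta ^+ 2 * gamma by rewrite mulr_gt0 // exprn_gt0.
have : 1 < r%:R * (delta ^+ 2 * gamma).
  rewrite -ltr_pdivrMr // mul1r; apply: le_lt_trans (archi_boundP _) => //.
  by rewrite invr_ge0 ltW.
rewrite -(ltr_pM2r V20) mul1r -(mulrA r%:R) -(mulrA _ gamma) => /lt_le_trans/(_ area).
by move=> /lt_le_trans/(_ (V2 _)); rewrite ltxx.
Qed.

(** * Greedy packing *)

Lemma exists_high_degree (R : realType) (V : finType) (e : rel V) (d : R)
    (X Y : {set V}) : (0 < #|X|)%N ->
  d * #|setX X Y|%:R <= #|setX X Y :&: arcs e|%:R ->
  exists2 x, x \in X & d * #|Y|%:R <= #|[set y in Y | e x y]|%:R.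
Proof.
move=> X0 dXY; apply/exists_inP; apply: contraLR dXY => /exists_inPn lowdeg.
have -> : #|setX X Y :&: arcs e| = (\sum_(x in X) #|[set y in Y | e x y]|)%N.
  rewrite -sum1_card; under [RHS]eq_bigr do rewrite -sum1_card.
  by rewrite pair_big_dep; apply: eq_bigl => -[x y]; rewrite !inE andbA.
rewrite -ltNge cardsX natrM mulrCA natr_sum -sum1_card natr_sum mulr_suml.
have [x0 x0X] := card_gt0P X0.
apply: ltr_sum => [|x xX]; first by apply/hasP; exists x0; rewrite ?mem_index_enum.
by rewrite mul1r ltNge lowdeg.
Qed.

(** Choose the [k] vertices one at a time: some vertex of [X'] is joined to a proportion [d] of
    [Y'], and [Y'] shrinks to its neighbours. The size hypotheses keep both sets large enough for
    lower density throughout. *)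
Lemma dense_biclique (R : realType) (V : finType) (e : rel V) (d delta : R)
    (X Y X' Y' : {set V}) (k : nat) :
  lower_dense e d delta X Y -> 0 <= delta -> 0 <= d <= 1 ->
  X' \subset X -> Y' \subset Y ->
  delta * #|X|%:R + k%:R <= #|X'|%:R -> delta * #|Y|%:R <= d ^+ k * #|Y'|%:R ->
  exists S Q : {set V}, [/\ S \subset X', Q \subset Y', #|S| = k,
    d ^+ k * #|Y'|%:R <= #|Q|%:R & forall x y, x \in S -> y \in Q -> e x y].
Proof.
move=> XY delta0 /andP[d0 d1]; elim: k X' Y' => [|k IH] X' Y' X'X Y'Y X'_large Y'_large.
  exists set0, Y'; split=> //; rewrite ?sub0set ?cards0 ?expr0 ?mul1r // => x y.
  by rewrite inE.
have X'_delta : delta * #|X|%:R <= #|X'|%:R.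
  by apply: le_trans X'_large; rewrite lerDl.
have Y'_delta : delta * #|Y|%:R <= #|Y'|%:R.
  by apply: le_trans Y'_large _; rewrite ler_piMl // exprn_ile1.
have XY' : d * #|setX X' Y'|%:R <= #|setX X' Y' :&: arcs e|%:R.
  by move/forallP/(_ X')/forallP/(_ Y'): XY; rewrite X'X Y'Y X'_delta Y'_delta.
have X'0 : (0 < #|X'|)%N.
  rewrite -(ltr_nat R); apply: lt_le_trans X'_large.
  by apply: ltr_wpDl; rewrite ?ltr0n // mulr_ge0.
have [x xX' xdeg] := exists_high_degree X'0 XY'.
have [| | | |S [Q [SX' QY' Sk Q_large SQ]]] := IH (X' :\ x) [set y in Y' | e x y].
- by apply: subset_trans X'X; apply: subD1set.
- by apply: subset_trans Y'Y; apply/subsetP => y; rewrite inE => /andP[].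
- by move: X'_large; rewrite (cardsD1 x X') xX' add1n -!natr1 addrA lerD2r.
- apply: le_trans Y'_large _; rewrite exprSr -mulrA ler_wpM2l //.
  exact: exprn_ge0.
exists (x |: S), Q; split.
- apply/subsetP => y; rewrite !inE => /orP[/eqP -> //|/(subsetP SX')].
  by rewrite !inE => /andP[].
- by apply: subset_trans QY' _; apply/subsetP => y; rewrite inE => /andP[].
- rewrite cardsU1 Sk; suff -> : x \notin S by [].
  by apply/negP => /(subsetP SX'); rewrite !inE eqxx.
- by apply: le_trans Q_large; rewrite exprSr -mulrA ler_wpM2l // exprn_ge0.
- move=> y z; rewrite inE => /orP[/set1P ->|yS] zQ; last exact: SQ.
  by move/(subsetP QY'): zQ; rewrite inE => /andP[].
Qed.

Definition biclique (V : finType) (e : rel V) (s t : nat)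
    (z : {set V} * {set V}) : Prop :=
  [/\ #|z.1| = s, #|z.2| = t & forall x y, x \in z.1 -> y \in z.2 -> e x y].

Definition tile_vertices (V : finType) (z : {set V} * {set V}) : {set V} :=
  z.1 :|: z.2.

Definition disjoint_tiles (V : finType) : rel ({set V} * {set V}) :=
  fun z z' => [disjoint tile_vertices z & tile_vertices z'].

Lemma greedy_packing (R : realType) (V T : finType) (e : rel V) (s t : nat)
    (p : V -> T) (al : rel T) (delta : R) :
  (forall i j (X Y : {set V}), al i j -> X \subset cell p i -> Y \subset cell p j ->
    delta * #|cell p i|%:R <= #|X|%:R -> delta * #|cell p j|%:R <= #|Y|%:R ->
    exists z : {set V} * {set V}, [/\ biclique e s t z, z.1 \subset X & z.2 \subset Y]) ->
  forall L : seq (T * T), {in L, forall ij, al ij.1 ij.2} ->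
  (forall i, (\sum_(ij <- L) (s * (ij.1 == i) + t * (ij.2 == i)))%:R
     <= (1 - delta) * #|cell p i|%:R) ->
  exists F : seq ({set V} * {set V}),
    [/\ size F = size L, {in F, forall z, biclique e s t z},
        pairwise (@disjoint_tiles V) F &
        forall i, (#|cell p i :&: \bigcup_(z <- F) tile_vertices z| <=
           \sum_(ij <- L) (s * (ij.1 == i) + t * (ij.2 == i)))%N].
Proof.
move=> find_biclique; elim=> [|[i j] L IH] L_al L_load.
  by exists [::]; split=> // i; rewrite !big_nil setI0 cards0.
have [|k|F [sizeF F_biclique F_disj F_load]] := IH.
- by move=> ij ijL; apply: L_al; rewrite inE ijL orbT.
- apply: le_trans (L_load k); rewrite ler_nat big_cons; exact: leq_addl.
pose U : {set V} := \bigcup_(z <- F) tile_vertices z.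
have free k : delta * #|cell p k|%:R <= #|cell p k :\: U|%:R.
  have := L_load k; rewrite big_cons => L_load_k.
  have : #|cell p k :&: U|%:R <= (1 - delta) * #|cell p k|%:R.
    apply: le_trans L_load_k; rewrite ler_nat; apply: leq_trans (F_load k) _.
    exact: leq_addl.
  by rewrite -(cardsID U (cell p k)) natrD; lra.
have alij : al i j by apply: (L_al (i, j)); apply: mem_head.
have [z [z_biclique zi zj]] := find_biclique i j _ _ alij
  (subsetDl (cell p i) U) (subsetDl (cell p j) U) (free i) (free j).
have [z1 z2 _] := z_biclique.
exists (z :: F); split=> /=.
- by rewrite sizeF.
- by move=> z'; rewrite inE => /predU1P[-> //|/F_biclique].
- rewrite F_disj andbT; apply/allP => z' z'F.
  rewrite /disjoint_tiles disjoint_sym disjoint_subset.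
  apply/subsetP => x xz'; have xU : x \in U.
    by rewrite /U (big_rem z') //= inE xz'.
  rewrite !inE; apply/norP; split; apply/negP; [move/(subsetP zi)|move/(subsetP zj)];
    by rewrite inE xU.
- move=> k; rewrite !big_cons setIUr; apply: leq_trans (leq_card_setU _ _) _.
  apply: leq_add (F_load k); rewrite setIUr; apply: leq_trans (leq_card_setU _ _) _.
  have part a (W : {set V}) n : W \subset cell p a :\: U -> #|W| = n ->
      (#|cell p k :&: W| <= n * (a == k))%N.
    move=> Wa Wn; case: eqP => [_|ak].
      by rewrite muln1 -Wn subset_leq_card // subsetIr.
    rewrite muln0 leqn0 cards_eq0; apply/eqP/setP => x; rewrite !inE.
    apply/negP => /andP[/eqP xk /(subsetP Wa)]; rewrite !inE xk => /andP[_ /eqP].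
    by move=> ?; apply: ak.
  by apply: leq_add; apply: part.
Qed.

Lemma card_preim_cells (V T : finType) (p : V -> T) (A : {set T}) :
  #|p @^-1: A| = (\sum_(i in A) #|cell p i|)%N.
Proof.
rewrite (card_fibers p) (bigID (mem A)) /= [X in (_ + X)%N]big1 ?addn0 => [|i iA].
  apply: eq_bigr => i iA; congr #|pred_of_set _|; apply/setP => x; rewrite !inE.
  by case: eqP => [->|_]; rewrite ?iA // andbF.
apply/eqP; rewrite cards_eq0; apply/eqP/setP => x; rewrite !inE.
by case: eqP => [->|_]; rewrite ?(negbTE iA) // andbF.
Qed.

(* Rounding a fractional tiling down loses less than one tile per pair of cells. *)
Lemma round_tiling (R : realType) (T : finType) (s t : nat) (u : R)
    (w : T -> T -> R) : 0 <= u -> (forall i j, 0 <= w i j) ->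
  exists L : seq (T * T), [/\ {in L, forall ij, w ij.1 ij.2 != 0},
    u * tiling_weight w <= (size L + #|T| ^ 2)%:R
    & forall k, (\sum_(ij <- L) (s * (ij.1 == k) + t * (ij.2 == k)))%:R
         <= u * tile_load s%:R t%:R w k].
Proof.
move=> u0 w0; pose N (ij : T * T) := Num.truncn (u * w ij.1 ij.2).
have uw0 ij : 0 <= u * w ij.1 ij.2 by rewrite mulr_ge0.
exists (flatten [seq nseq (N ij) ij | ij <- enum {: T * T}]).
have sumL (f : T * T -> nat) :
    (\sum_(ij <- flatten [seq nseq (N ij) ij | ij <- enum {: T * T}]) f ij =
     \sum_ij N ij * f ij)%N.
  rewrite big_flatten big_map big_enum /=; apply: eq_bigr => ij _.
  by rewrite big_nseq iter_addn_0 mulnC.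
split=> [ij /flatten_mapP[kl _]|| k].
- rewrite mem_nseq => /andP[N0 /eqP ->]; apply: contraTneq N0 => w00.
  by rewrite /N w00 mulr0 truncn0.
- rewrite -sum1_size sumL natrD natr_sum.
  have -> : (#|T| ^ 2)%:R = \sum_(ij : T * T) (1 : R).
    by rewrite sumr_const card_prod -mulnn.
  rewrite weight_pairs mulr_sumr -big_split; apply: ler_sum => ij _ /=.
  by rewrite muln1; have /andP[_ /ltW] := truncn_itv (uw0 ij); rewrite -natr1.
rewrite sumL natr_sum load_pairs mulr_sumr; apply: ler_sum => ij _.
rewrite natrM natrD !natrM [leRHS]mulrCA [leRHS]mulrC.
apply: ler_wpM2r; first by rewrite addr_ge0 ?mulr_ge0.
by have /andP[] := truncn_itv (uw0 ij).
Qed.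

Lemma card_small_cells (V T : finType) (p : V -> T) (m : nat) :
  (#|[set x | #|cell p (p x)| < m]| <= #|T| * m)%N.
Proof.
rewrite (card_fibers p) -sum_nat_const; apply: leq_sum => i _.
have [small|large] := ltnP #|cell p i| m.
  apply: leq_trans (ltnW small); apply/subset_leq_card/subsetP => x.
  by rewrite !inE => /andP[].
rewrite [X in (X <= _)%N](_ : _ = 0%N) //.
apply/eqP; rewrite cards_eq0; apply/eqP/setP => x; rewrite !inE.
by case: eqP => [->|_]; rewrite ?andbF // ltnNge large.
Qed.

(** The sets [A] and [C] are unions of the cells supplied by [tiling_duality]; [c] pays for rounding
    the fractional tiling. *)
Lemma biclique_tiling (R : realType) (s t : nat) (theta delta0 : R) :
  (0 < s)%N -> (s <= t)%N -> 0 < theta -> 0 < delta0 -> delta0 <= 1 ->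
  exists n0 c : nat, forall (V : finType) (e : rel V), (n0 <= #|V|)%N ->
  exists (F : seq ({set V} * {set V})) (A C : {set V}),
  [/\ {in F, forall z, biclique e s t z}, pairwise (@disjoint_tiles V) F,
      [disjoint A & C],
      (1 - delta0) * (#|A|%:R / s%:R + #|~: (A :|: C)|%:R / (s%:R + t%:R))
         <= (size F + c)%:R
    & #|setX (~: A) C :&: arcs e|%:R <= theta * #|V|%:R ^+ 2].
Proof.
move=> s0 st theta0 delta00 delta01.
pose d : R := Num.min 1 (theta / 4).
have theta4 : 0 < theta / 4 by lra.
have d0 : 0 < d by rewrite lt_min ltr01.
have d1 : d <= 1 by rewrite ge_min lexx.
have dt : d <= theta / 4 by rewrite ge_min lexx orbT.
have ds0 : 0 < d ^+ s * delta0 by rewrite mulr_gt0 // exprn_gt0.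
have ds1 : d ^+ s <= 1 by rewrite exprn_ile1 // ltW.
pose delta := d ^+ s * delta0 / 2.
have delta_gt0 : 0 < delta by rewrite divr_gt0.
have delta_le : delta <= delta0 / 2.
  by rewrite ler_pM2r ?invr_gt0 // ler_piMl // ltW.
have [K partK] := dense_partition (ltW d0) delta_gt0 theta4.
(* In cells with at least [x] vertices, a [delta0] share leaves room to choose [s] vertices on one
   side and still has [t] common neighbours on the other. *)
pose x := (2 * s%:R + t%:R) / (d ^+ s * delta0).
pose m := Num.bound x.
have x0 : 0 <= x by apply: divr_ge0; [rewrite addr_ge0 ?mulr_ge0 | exact: ltW].
have mx : x <= m%:R by rewrite ltW // archi_boundP.
pose y := (K * m)%:R * 2 / (theta / 4).
have y0 : 0 <= y by apply: divr_ge0; [rewrite mulr_ge0 | exact: ltW].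
exists (Num.bound y), (K ^ 2)%N => V e V_large.
have [T [p [D [TK D_sparse bad_small]]]] := partK V e.
pose al i j := [&& ~~ D i j, lower_dense e d delta (cell p i) (cell p j),
  (m <= #|cell p i|)%N & (m <= #|cell p j|)%N].
pose v i : R := #|cell p i|%:R.
have [||//|w [A [C [[w_ge0 w_al w_load] dAC AC weightA]]]] :=
  @tiling_duality R T al v s%:R t%:R.
- by rewrite ltr0n.
- by rewrite ler_nat.
(* Scaling by [1 - delta0] reserves the share of each cell that the greedy packing must keep
   free. *)
have [|//|L [L_supp L_size L_load]] := @round_tiling R T s t (1 - delta0) w.
  by rewrite subr_ge0.
have [|||F [sizeF F_bic F_disj _]] := @greedy_packing R V T e s t p al delta0 _ L.
- move=> i j X Y /and4P[_ ij mi mj] Xi Yj X_large Y_large.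
  have bound k : (m <= #|cell p k|)%N ->
      2 * s%:R + t%:R <= d ^+ s * delta0 * #|cell p k|%:R.
    move=> mk; rewrite [leRHS]mulrC -ler_pdivrMr //; apply: le_trans mx _.
    by rewrite ler_nat.
  have deltaE k : delta * #|cell p k|%:R = d ^+ s * delta0 * #|cell p k|%:R / 2.
    by rewrite /delta mulrAC.
  have dsX : d ^+ s * delta0 * #|cell p i|%:R <= delta0 * #|cell p i|%:R.
    by rewrite ler_wpM2r // ler_piMl // ltW.
  have dsY : d ^+ s * delta0 * #|cell p j|%:R <= d ^+ s * #|Y|%:R.
    by rewrite -mulrA ler_wpM2l // exprn_ge0 // ltW.
  have [s_ge0 t_ge0] : 0 <= s%:R :> R /\ 0 <= t%:R :> R by [].
  have := bound i mi; have := bound j mj => bj bi.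
  have [||||S [Q [SX QY Sk Q_large SQ]]] := dense_biclique (k := s) ij _ _ Xi Yj.
  - exact: ltW.
  - by rewrite (ltW d0).
  - by rewrite deltaE; lra.
  - by rewrite deltaE; lra.
  have /card_geqP[r [r_uniq rt rQ]] : (t <= #|Q|)%N by rewrite -(ler_nat R); lra.
  exists (S, [set x in r]); split=> //=.
    split=> //=; first by rewrite cardsE -rt; apply/card_uniqP.
    by move=> a b aS; rewrite inE => /rQ; apply: SQ.
  by apply: subset_trans QY; apply/subsetP => a; rewrite inE => /rQ.
- by move=> ij /L_supp; apply: contraNT => /w_al ->.
- move=> k; apply: le_trans (L_load k) _; rewrite ler_wpM2l // ?subr_ge0 //.
exists F, (p @^-1: A), (p @^-1: C); split=> //.
- rewrite disjoint_subset; apply/subsetP => z; rewrite !inE => zA.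
  by rewrite (disjointFr dAC zA).
- have sumv (B : {set T}) : #|p @^-1: B|%:R = \sum_(i in B) v i.
    by rewrite card_preim_cells natr_sum.
  have -> : ~: (p @^-1: A :|: p @^-1: C) = p @^-1: (~: (A :|: C)).
    by apply/setP => z; rewrite !inE.
  apply: le_trans (_ : (size L + #|T| ^ 2)%:R <= _); last first.
    by rewrite ler_nat sizeF leq_add2l leq_exp2r.
  apply: le_trans L_size; rewrite ler_wpM2l ?subr_ge0 //.
  apply: le_trans weightA; rewrite !sumv !mulr_suml.
  rewrite [leRHS](bigID (mem A)) /= lerD //.
    by apply: ler_sum => i iA; rewrite iA.
  rewrite [leRHS](bigID (mem C)) /= ler_wpDl //.
    by apply: sumr_ge0 => i /andP[/negbTE -> ->]; rewrite mulr0.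
  rewrite le_eqVlt; apply/orP; left; apply/eqP.
  apply: eq_big => i; rewrite !inE negb_or //.
  by move=> /andP[/negbTE -> /negbTE ->].
(* An arc from outside [A] into [C] joins a pair of cells that is not allowed: a discarded one, a
   bad one, or one with a small cell. Each of these three kinds accounts for at most [theta / 4] of
   all pairs. *)
pose Sm := [set x | (#|cell p (p x)| < m)%N].
have sub : setX (~: (p @^-1: A)) (p @^-1: C) :&: arcs e \subset
    (region p D :&: arcs e) :|: region p (not_lower_dense e d delta p D) :|:
    setX Sm setT :|: setX setT Sm.
  apply/subsetP => -[a b]; rewrite !inE /= !andbT => /andP[/andP[aA bC] ab].
  have : ~~ al (p a) (p b) by apply: contra aA; apply: AC.
  rewrite /al /not_lower_dense ab andbT !negb_and !negbK -!ltnNge.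
  by case: (D _ _) => //=; case: (lower_dense _ _ _ _ _).
have Sm_small : #|Sm|%:R <= (K * m)%:R :> R.
  by rewrite ler_nat; apply: leq_trans (card_small_cells p m) _; rewrite leq_mul.
have : (K * m)%:R * 2 <= theta / 4 * #|V|%:R.
  rewrite [leRHS]mulrC -ler_pdivrMr //; apply: le_trans (_ : (Num.bound y)%:R <= _).
    by rewrite ltW // archi_boundP.
  by rewrite ler_nat.
have V0 : 0 <= #|V|%:R :> R by [].
move=> /(ler_wpM2r V0); have := ler_wpM2r V0 Sm_small.
have dV : d * #|V|%:R ^+ 2 <= theta / 4 * #|V|%:R ^+ 2 by rewrite ler_wpM2r ?exprn_ge0.
have thetaV : 0 <= theta * #|V|%:R ^+ 2 by rewrite mulr_ge0 ?exprn_ge0 // ltW.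
have := subset_leq_card sub; rewrite -(ler_nat R).
have cardU (X Y : {set V * V}) : #|X :|: Y|%:R <= #|X|%:R + #|Y|%:R :> R.
  by rewrite -natrD ler_nat leq_card_setU.
have := cardU (region p D :&: arcs e :|: region p (not_lower_dense e d delta p D) :|:
    setX Sm setT) (setX setT Sm).
have := cardU (region p D :&: arcs e :|: region p (not_lower_dense e d delta p D))
    (setX Sm setT).
have := cardU (region p D :&: arcs e) (region p (not_lower_dense e d delta p D)).
rewrite !cardsX !cardsT !natrM; move: D_sparse bad_small dV thetaV; rewrite !expr2.
lra.
Qed.

(** * Copies and edges *)

Lemma exists_bijection (A B : finType) (X : {set A}) (S : {set B}) (y0 : B) :
  #|X| = #|S| -> exists2 g : A -> B, {in X &, injective g} & g @: X = S.
Proof.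
move=> XS; pose g x := nth y0 (enum S) (index x (enum X)).
have lt_index x : x \in X -> (index x (enum X) < size (enum S))%N.
  by move=> xX; rewrite -cardE -XS cardE index_mem mem_enum.
have gS x : x \in X -> g x \in S.
  by move=> xX; rewrite -mem_enum; apply/mem_nth/lt_index.
have g_inj : {in X &, injective g}.
  move=> x y xX yX /eqP; rewrite nth_uniq ?lt_index ?enum_uniq // => /eqP exy.
  by have := congr1 (nth x (enum X)) exy; rewrite !nth_index ?mem_enum.
exists g => //; apply/eqP; rewrite eqEcard (card_in_imset g_inj) XS leqnn andbT.
by apply/subsetP => _ /imsetP[x xX ->]; apply: gS.
Qed.

Lemma s_of_gt0 (H : sgraph) : bipartite H -> no_isolated_vertex H -> (0 < s_of H)%N.
Proof.
move=> /min_colouringP/andP[/forallP bP _] noiso.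
have /card_gt0P[x _] := vertex_gt0 H; have [y xy] := noiso x.
have /forallP/(_ y) := bP x; rewrite xy /= => bxy.
apply/card_gt0P; exists (if min_colouring H x then x else y); rewrite inE.
by move: bxy; case bx: (min_colouring H x); rewrite ?bx //; case: (min_colouring H y).
Qed.

(** The colour classes of the minimal colouring are mapped bijectively to the two sides, which are
    disjoint because adjacency is irreflexive. Only images of edges of [H] are kept. *)
Lemma biclique_copy (H G : sgraph) (z : {set G} * {set G}) : bipartite H ->
  biclique (@adj G) (s_of H) (t_of H) z ->
  exists S : subgraph G, is_copy H S /\ sub_vertices S = tile_vertices z.
Proof.
move=> /min_colouringP/andP[/forallP bP _] [z1 z2 zadj].
have /card_gt0P[y0 _] := vertex_gt0 G; pose b := min_colouring H.
have [g1 g1_inj g1S] := exists_bijection y0 (esym z1).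
have [g2 g2_inj g2S] := exists_bijection y0 (esym z2).
pose f x := if b x then g1 x else g2 x.
have fz x : if b x then f x \in z.1 else f x \in z.2.
  rewrite /f; case bx: (b x); rewrite -?g1S -?g2S; apply: imset_f;
  by rewrite inE -/b bx.
have f_adj x y : adj x y -> adj (f x) (f y).
  move=> xy; have /forallP/(_ y) := bP x; rewrite xy /= -/b.
  have := fz x; have := fz y; case: (b x); case: (b y) => // fy fx _.
    exact: zadj.
  by rewrite adj_sym; apply: zadj.
have f_inj : injective f.
  have dis u : u \in z.1 -> u \in z.2 -> False.
    by move=> u1 u2; have := zadj _ _ u1 u2; rewrite adj_irrefl.
  move=> x y fxy; move: (fz x) (fz y); rewrite fxy.
  case bx: (b x); case bY: (b y).
  - move=> _ _; apply: g1_inj; rewrite ?inE -/b ?bx ?bY //.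
    by move: fxy; rewrite /f bx bY.
  - by move=> h1 h2; case: (dis _ h1 h2).
  - by move=> h1 h2; case: (dis _ h2 h1).
  - move=> _ _; apply: g2_inj; rewrite ?inE -/b ?bx ?bY //.
    by move: fxy; rewrite /f bx bY.
have f_im : f @: [set: H] = tile_vertices z.
  apply/setP => y; apply/imsetP/setUP => [[x _ ->]|].
    by have := fz x; case: (b x); [left|right].
  rewrite -g1S -g2S => -[] /imsetP[x]; rewrite inE -/b => /eqP bx ->; exists x => //;
  by rewrite /f bx.
pose sa : rel G := fun x y => [exists u, exists v, [&& adj u v, f u == x & f v == y]].
have saP x y : reflect (exists u v, [/\ adj u v, f u = x & f v = y]) (sa x y).
  apply: (iffP existsP) => [[u /existsP[v /and3P[uv /eqP fu /eqP fv]]]|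
      [u [v [uv fu fv]]]].
    by exists u, v.
  by exists u; apply/existsP; exists v; rewrite uv fu fv !eqxx.
have sa_sym : symmetric sa.
  by move=> x y; apply/saP/saP => -[u [v [uv fu fv]]]; exists v, u; rewrite adj_sym.
have sa_vertices x y : sa x y -> x \in tile_vertices z.
  by move=> /saP[u [v [_ <- _]]]; rewrite -f_im imset_f.
have sa_adj x y : sa x y -> adj x y.
  by move=> /saP[u [v [uv <- <-]]]; apply: f_adj.
exists (Subgraph sa_sym sa_vertices sa_adj); split=> //=.
exists f; split=> // x y; apply/saP/idP => [[u [v [uv /f_inj <- /f_inj <-]]] //|xy].
by exists x, y.
Qed.

Lemma tiles_copies (H G : sgraph) (F : seq ({set G} * {set G})) : bipartite H ->
  {in F, forall z, biclique (@adj G) (s_of H) (t_of H) z} ->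
  pairwise (@disjoint_tiles G) F ->
  exists C : 'I_(size F) -> subgraph G, vertex_disjoint_copies H C.
Proof.
move=> Hbip F_bic F_disj; pose z i := nth (set0, set0) F i.
have /fin_all_exists[C CP] (i : 'I_(size F)) :
    exists S : subgraph G, is_copy H S /\ sub_vertices S = tile_vertices (z i).
  by apply: biclique_copy => //; apply/F_bic/mem_nth.
exists C; split=> [i|i j ij]; first by have [] := CP i.
have [_ ->] := CP i; have [_ ->] := CP j.
have dis (k l : 'I_(size F)) : (k < l)%N ->
    [disjoint tile_vertices (z k) & tile_vertices (z l)].
  by move=> kl; apply: (pairwiseP (set0, set0) F_disj) => //; rewrite inE.
have [|lt_ji|ijE] := ltngtP i j; first exact: dis.
  by rewrite disjoint_sym; apply: dis.
by case/eqP: ij; apply: val_inj.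
Qed.

(** * Edge counts and the threshold function *)

Lemma edges_le_arcs (G : sgraph) : (2 * #|edges G| <= #|arcs (@adj G)|)%N.
Proof.
rewrite mulnC -sum_nat_const.
pose h (z : G * G) := [set z.1; z.2].
rewrite -[X in (_ <= X)%N]sum1_card (partition_big h (mem (edges G))) /=; last first.
  by move=> z; rewrite inE => zadj; apply/imsetP; exists z; rewrite ?inE.
apply: leq_sum => _ /imsetP[[x y] +] ->; rewrite inE /= => xy.
have xNy : x != y by apply: contraTneq xy => ->; rewrite adj_irrefl.
rewrite sum1dep_card -[X in (X <= _)%N](_ : #|[set (x, y); (y, x)]| = 2).
  apply/subset_leq_card/subsetP => z; rewrite !inE => /orP[/eqP -> | /eqP ->] /=.
    by rewrite xy eqxx.
  by rewrite adj_sym xy /h setUC eqxx.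
by rewrite cards2 xpair_eqE (negbTE xNy).
Qed.

(** An arc meets [A], or lies inside the remaining part [~: (A :|: C)], or joins [C] to the
    complement of [A] in one of the two directions. *)
Lemma card_arcs_le (R : realType) (V : finType) (e : rel V) (A C : {set V})
    (n := #|V|%:R : R) (a := #|A|%:R : R) :
  symmetric e ->
  #|arcs e|%:R <= 2 * a * n - a ^+ 2 + #|~: (A :|: C)|%:R ^+ 2
     + 2 * #|setX (~: A) C :&: arcs e|%:R.
Proof.
move=> e_sym; pose B := ~: (A :|: C); pose X := setX (~: A) C :&: arcs e.
pose swap (z : V * V) := (z.2, z.1).
have sub : arcs e \subset ~: setX (~: A) (~: A) :|: setX B B :|: X :|: swap @: X.
  apply/subsetP => -[x y]; rewrite !inE /= => xy; rewrite xy.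
  have [//|xA] := boolP (x \in A); have [//|yA] := boolP (y \in A).
  have [yC|yC] := boolP (y \in C); rewrite ?orbT //=.
  have [xC|xC] //= := boolP (x \in C).
  apply/imsetP; exists (y, x) => //; by rewrite !inE /= xC yA e_sym.
have : (#|arcs e| <= #|~: setX (~: A) (~: A)| + #|B| * #|B| + #|X| + #|X|)%N.
  apply: leq_trans (subset_leq_card sub) _.
  apply: leq_trans (leq_card_setU _ _) _; apply: leq_add (leq_imset_card _ _).
  apply: leq_trans (leq_card_setU _ _) _; rewrite leq_add2r.
  by apply: leq_trans (leq_card_setU _ _) _; rewrite cardsX.
have nA : #|~: A|%:R = n - a by rewrite /n -(cardsC A) natrD addrAC subrr add0r.
have := cardsC (setX (~: A) (~: A)); rewrite cardsX card_prod.
move=> /(congr1 (fun k => k%:R : R)); rewrite natrD !natrM nA => cardC.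
rewrite -(ler_nat R) !natrD natrM -/B -/X !expr2; rewrite -/n in cardC.
lra.
Qed.

(** The form [2 * x - x ^+ 2] is the proportion of ordered pairs meeting a set of relative size
    [x]. *)
Lemma T_funE (R : realType) (s t : nat) (alpha : R)
    (x := s%:R / (s%:R + t%:R) * alpha) : (0 < s)%N ->
  T_fun s t alpha = Num.max (2 * x - x ^+ 2) (alpha ^+ 2).
Proof.
move=> s0; congr Num.max; rewrite /x; field.
by rewrite -natrD pnatr_eq0 addn_eq0 negb_and -lt0n s0.
Qed.

Lemma s_fraction_itv (R : realType) (s t : nat) : (0 < s)%N ->
  0 < (s%:R / (s%:R + t%:R) : R) <= 1.
Proof.
move=> s0; have st0 : 0 < s%:R + t%:R :> R by rewrite -natrD ltr0n addn_gt0 s0.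
by rewrite divr_gt0 ?ltr0n //= ler_pdivrMr // mul1r lerDl.
Qed.

Lemma T_fun_increasing (R : realType) (s t : nat) (alpha beta : R) : (0 < s)%N ->
  0 < beta -> beta < alpha -> alpha < 1 -> T_fun s t beta < T_fun s t alpha.
Proof.
move=> s0 b0 ba a1; rewrite !T_funE //.
have /andP[] := s_fraction_itv R t s0; set u := _ / _ => u0 u1.
have ub : u * beta < u * alpha by rewrite ltr_pM2l.
have ua : u * alpha < 1.
  by apply: le_lt_trans a1; rewrite ler_piMl // ltW // (lt_trans b0).
rewrite gt_max !lt_max; apply/andP; split; apply/orP; [left | right].
  have : 0 < u * beta by rewrite mulr_gt0.
  by move: ub ua; set y := u * beta; set z := u * alpha => ? ? ?; nra.
by rewrite ltr_pXn2r // nnegrE ltW // (lt_trans b0).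
Qed.

(* With [x = s beta / (s + t)], the left-hand side is convex in [a] on the segment
   [a / x + b / beta = n], whose endpoints give the two terms of the maximum. *)
Lemma threshold_edges_le (R : realType) (s t : nat) (beta a b n : R) :
  (0 < s)%N -> 0 < beta -> 0 < n -> 0 <= a -> 0 <= b ->
  a / s%:R + b / (s%:R + t%:R) <= beta * n / (s%:R + t%:R) ->
  2 * a * n - a ^+ 2 + b ^+ 2 <= T_fun s t beta * n ^+ 2.
Proof.
move=> s0 beta0 n0 a0 b0; rewrite T_funE //.
have /andP[] := s_fraction_itv R t s0; set u := _ / _ => u0 u1.
have s_gt0 : 0 < s%:R :> R by rewrite ltr0n.
have st0 : 0 < s%:R + t%:R :> R by rewrite -natrD ltr0n addn_gt0 s0.
rewrite -(ler_pM2r st0) mulrDl !divfK ?gt_eqF //.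
have -> : a / s%:R * (s%:R + t%:R) = a / u.
  by rewrite /u; field; rewrite !gt_eqF.
(* The parameter [l] is the position on the segment: [l = 1] is the end with [b = 0], and [l = 0]
   the end with [a = 0]. *)
move=> ab; pose l := a / (u * beta * n).
have ubn : 0 < u * beta * n by do 2!apply: mulr_gt0 => //.
have l0 : 0 <= l by apply: divr_ge0 => //; apply: ltW.
have aE : a = l * (u * beta * n) by rewrite divfK // gt_eqF.
have bE : b <= (1 - l) * beta * n.
  have auE : a / u = l * beta * n by rewrite /l; field; rewrite !gt_eqF.
  by move: ab; rewrite auE; lra.
set M := Num.max _ _.
have M1 : 2 * (u * beta) - (u * beta) ^+ 2 <= M by rewrite le_max lexx.
have M2 : beta ^+ 2 <= M by rewrite le_max lexx orbT.
have l1 : l <= 1.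
  rewrite -subr_ge0 -(pmulr_lge0 _ (mulr_gt0 beta0 n0)).
  by rewrite mulrA; apply: le_trans bE.
have b2 : b ^+ 2 <= ((1 - l) * beta * n) ^+ 2.
  by rewrite ler_pXn2r // nnegrE (le_trans b0).
apply: le_trans (_ : (2 * l * (u * beta) - (l * (u * beta)) ^+ 2 +
    ((1 - l) * beta) ^+ 2) * n ^+ 2 <= _).
  by rewrite {1 2}aE; move: b2; nra.
rewrite ler_wpM2r // ?sqr_ge0 //.
have ub : (u * beta) ^+ 2 <= beta ^+ 2.
  have ub0 : 0 <= u * beta by apply: mulr_ge0; apply: ltW.
  by rewrite ler_pXn2r ?nnegrE // ?ler_piMl // ltW.
(* This is exactly the excess of the chord between the two endpoint values over the value at [l]. *)
have : 0 <= l * (1 - l) * (beta ^+ 2 - (u * beta) ^+ 2).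
  by apply: mulr_ge0; [apply: mulr_ge0 | ]; rewrite ?subr_ge0.
have : l * (2 * (u * beta) - (u * beta) ^+ 2) <= l * M by rewrite ler_wpM2l.
have : (1 - l) * beta ^+ 2 <= (1 - l) * M by rewrite ler_wpM2l ?subr_ge0.
by move: (u * beta) @M {M1 M2} => p M; lra.
Qed.

Lemma natr_bin2 (R : realType) (n : nat) :
  2 * 'C(n, 2)%:R = n%:R ^+ 2 - n%:R :> R.
Proof.
case: n => [|n]; first by rewrite bin0n mulr0 expr2 mulr0 subr0.
have : ('C(n.+1, 2) * 2 = n.+1 * n)%N.
  by rewrite (bin_ffact n.+1 2) !ffactnS ffactn0 muln1.
by move=> /(congr1 (fun k => k%:R : R)); rewrite !natrM -natr1; lra.
Qed.

Theorem theorem2 (R : realType) (s t : nat) (alpha eps : R)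
    (alpha_gt0 : 0 < alpha) (alpha_lt1 : alpha < 1) (eps_gt0 : 0 < eps) :
  exists n0 : nat,
    forall H : sgraph, bipartite H -> no_isolated_vertex H ->
      s_of H = s -> t_of H = t ->
    forall n : nat, (n0 <= n)%N ->
    forall G : sgraph, #|G| = n ->
      T_fun s t alpha * 'C(n, 2)%:R <= #|edges G|%:R ->
    exists (k : nat) (C : 'I_k -> subgraph G),
      vertex_disjoint_copies H C /\
      (1 - eps) * (alpha / (s%:R + t%:R)) * n%:R < k%:R.
Proof.
(* If [s = 0] or [t < s], no graph [H] qualifies and any [n0] will do. *)
have [|s0] := posnP s.
  move=> s00; exists 0%N => H Hbip noiso Hs.
  by have := s_of_gt0 Hbip noiso; rewrite Hs s00.
have [ts|st] := ltnP t s.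
  exists 0%N => H Hbip noiso Hs Ht.
  by have := s_of_le_t_of Hbip; rewrite Hs Ht leqNgt ts.
have st0 : 0 < s%:R + t%:R :> R by rewrite -natrD ltr0n addn_gt0 s0.
(* Capping [eps] keeps [beta] positive. *)
pose eps' : R := Num.min eps (1 / 2).
have eps'0 : 0 < eps' by rewrite lt_min eps_gt0; lra.
have eps'_le : eps' <= eps by rewrite ge_min lexx.
have eps'1 : eps' <= 1 / 2 by rewrite ge_min lexx orbT.
pose beta := (1 - eps' / 2) * alpha.
have beta0 : 0 < beta by apply: mulr_gt0 => //; lra.
have beta_lt : beta < alpha by rewrite /beta gtr_pMl //; lra.
pose kappa := T_fun s t alpha - T_fun s t beta.
have kappa0 : 0 < kappa by rewrite subr_gt0 T_fun_increasing.
have [|||n1 [c tiling]] := @biclique_tiling R s t (kappa / 8) (eps' / 4) s0 st.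
- by lra.
- by lra.
- by lra.
pose q := alpha / (s%:R + t%:R).
have q0 : 0 < q by apply: divr_gt0.
(* Beyond [y1] the additive loss [c] is below [eps' / 4 * q * n]; beyond [y2] the linear term of the
   binomial coefficient costs less than [kappa / 2] of $n^2$. *)
pose y1 := c%:R / (eps' / 4 * q).
pose y2 := T_fun s t alpha * 2 / kappa.
have epsq : 0 < eps' / 4 * q by apply: mulr_gt0 => //; lra.
have Ta0 : 0 <= T_fun s t alpha by rewrite le_max sqr_ge0 orbT.
have y1_ge0 : 0 <= y1 by apply: divr_ge0 => //; apply: ltW.
have y2_ge0 : 0 <= y2 by apply: divr_ge0; [apply: mulr_ge0 | apply: ltW].
exists (n1 + (Num.bound y1 + Num.bound y2))%N.
move=> H Hbip noiso Hs Ht n n_large G Gn G_edges.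
have n_gt1 : c%:R < eps' / 4 * q * n%:R.
  rewrite [ltRHS]mulrC -ltr_pdivrMr //; apply: lt_le_trans (archi_boundP y1_ge0) _.
  by rewrite ler_nat (leq_trans _ n_large) // addnCA leq_addr.
have n_gt2 : T_fun s t alpha * 2 < kappa * n%:R.
  rewrite [ltRHS]mulrC -ltr_pdivrMr //; apply: lt_le_trans (archi_boundP y2_ge0) _.
  by rewrite ler_nat (leq_trans _ n_large) // addnA leq_addl.
have n0 : 0 < n%:R :> R.
  rewrite -(pmulr_rgt0 _ kappa0); apply: le_lt_trans n_gt2; exact: mulr_ge0.
have [|F [A [C [F_bic F_disj dAC F_size sparse]]]] := tiling G (@adj G).
  by rewrite Gn (leq_trans _ n_large) // leq_addr.
have {}F_bic : {in F, forall z, biclique (@adj G) (s_of H) (t_of H) z}.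
  by move=> z zF; rewrite Hs Ht; apply: F_bic.
have [copies copiesP] := tiles_copies Hbip F_bic F_disj.
exists (size F), copies; split=> //; rewrite -/q.
have [small|large] := lerP
    (#|A|%:R / s%:R + #|~: (A :|: C)|%:R / (s%:R + t%:R))
    (beta * n%:R / (s%:R + t%:R)).
  (* A small tiling is contradictory: in units of $n^2$, twice the edge number is at most
     [T_fun s t beta + kappa / 4], but more than [T_fun s t alpha - kappa / 2], while these
     thresholds differ by [kappa]. *)
  have := threshold_edges_le s0 beta0 n0 (ler0n _ _) (ler0n _ _) small.
  have := card_arcs_le R A C (@adj_sym G).
  have := edges_le_arcs G; rewrite -(ler_nat R) natrM Gn.
  move: sparse; rewrite Gn.
  have binE := natr_bin2 R n.
  have n2 : 0 < kappa * n%:R ^+ 2 by rewrite mulr_gt0 ?exprn_gt0.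
  have : T_fun s t alpha * (n%:R ^+ 2 - n%:R) <= 2 * #|edges G|%:R.
    by rewrite -binE mulrCA ler_pM2l.
  have : T_fun s t alpha * 2 * n%:R < kappa * n%:R * n%:R by rewrite ltr_pM2r.
  move: n2; rewrite /kappa !expr2; lra.
have qbeta : beta * n%:R / (s%:R + t%:R) = (1 - eps' / 2) * (q * n%:R).
  by rewrite /q /beta; field; rewrite gt_eqF.
have qn0 : 0 < q * n%:R by apply: mulr_gt0.
(* The two factors and the loss [c] cost at most [eps' / 4], [eps' / 2] and [eps' / 4] of [q * n],
   hence [eps'] in all. *)
have : (1 - eps' / 4) * ((1 - eps' / 2) * (q * n%:R)) < (size F + c)%:R.
  apply: lt_le_trans F_size; rewrite -qbeta ltr_pM2l //; lra.
rewrite natrD.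
have : 0 <= eps' ^+ 2 * (q * n%:R) by rewrite mulr_ge0 ?sqr_ge0 // ltW.
have : eps' * (q * n%:R) <= eps * (q * n%:R) by rewrite ler_pM2r.
move: n_gt1; rewrite -!mulrA; move: (q * n%:R) => Q.
lra.
Qed.
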